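(* Consider a power network with $n\ge 1$ buses, of which $n_G$ are generator buses and $n_V$ are required to have fixed voltage magnitude, and let (P) be the semidefinite relaxation of an associated optimal power flow problem, with dual (D). Suppose that (P), (D) satisfy the Slater condition, that strict complementarity holds between any pair of primal-dual optimal solutions, and that the equality-constraint matrices $A_1,\dots,A_m$ are linearly independent. Suppose that $X^\circ\in\mathcal{P}^\circ$ is a primal nondegenerate optimal solution of (P). If $$n_G\le\tfrac12\bigl(a(X^\circ)+n_V\bigr),$$ then $\operatorname{rank}(X)>1$ for all $X\in\mathcal{P}^\circ$. In particular, if $n_G\le\tfrac12 n_V$, then $\operatorname{rank}(X)>1$ for all $X\in\mathcal{P}^\circ$.
   Context: Let $\mathcal{H}^n$ be the real vector space (dimension $n^2$) of Hermitian $n\times n$ complex matrices. For $n\times n$ complex matrices write $A\bullet B=\sum_{i,j}a_{ij}\overline{b_{ij}}$ (an inner product on $\mathcal{H}^n$); linear independence of Hermitian matrices is over $\mathbb{R}$. $A\succeq 0$ ($A\succ 0$) means $A$ is Hermitian positive semidefinite (definite). $e_i$ is the $i$-th standard basis vector of $\mathbb{R}^n$. General form of the programs, with $C,A_1,\dots,A_{m+\ell}\in\mathcal{H}^n$ and $b\in\mathbb{R}^{m+\ell}$: (P): minimize $C\bullet X$ over $X\in\mathcal{H}^n$ subject to $A_k\bullet X=b_k$ for $k\in\mathcal{E}:=\{1,\dots,m\}$, $A_k\bullet X\le b_k$ for $k\in\mathcal{I}:=\{m+1,\dots,m+\ell\}$, and $X\succeq 0$. (D): maximize $-b^\top y$ over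 $y\in\mathbb{R}^{m+\ell}$ subject to $Z(y):=C+\sum_{k=1}^{m+\ell}y_kA_k\succeq 0$ and $y_k\ge 0$ for $k\in\mathcal{I}$. Semidefinite relaxation of OPF: the buses are $\mathcal{N}=\{1,\dots,n\}$, $\mathcal{N}_G\subseteq\mathcal{N}$ is the set of generator buses with $n_G=|\mathcal{N}_G|$, and $\mathcal{N}_V\subseteq\mathcal{N}$ is the set of buses with fixed voltage magnitude, $n_V=|\mathcal{N}_V|$. $Y\in\mathbb{C}^{n\times n}$ is the network admittance matrix and $S_D\in\mathbb{C}^n$ the vector of complex power demands. In the OPF problem the variable is the vector of bus voltages $V\in\mathbb{C}^n$, all constraints and the cost are expressed through $X=VV^*$, and the relaxation (P) is obtained by letting $X$ range over all Hermitian positive semidefinite matrices (dropping the rank-one constraint). Its constraints include: - for each load bus $i\in\mathcal{N}\setminus\mathcal{N}_G$, the power balance equation $S_{D_i}+(Y^*e_ie_i^\top)\bullet X=0$, which counts as two real equality constraints (real and imaginary part, each of the form $A_k\bullet X=b_k$ with $A_k$ Hermitian); - for each $i\in\mathcal{N}_G$, the inequality constraints $P_{G_i}^{\min}\le\operatorname{Re}\{S_{D_i}+(Y^*e_ie_i^\top)\bullet X\}\le P_{G_i}^{\max}$ and $Q_{G_i}^{\min}\le\operatorname{Im}\{S_{D_i}+(Y^*e_ie_i^\top)\bullet X\}\le Q_{G_i}^{\max}$; - for each $i\in\mathcal{N}_V$, the equality constraint $(e_ie_i^\top)\bullet X=\overline V_i^{\,2}$, where $\overline V_i$ is the required voltage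 magnitude. Further constraints of the form allowed in (P) (e.g. on line flows or voltage magnitudes) may be present. All the equalities listed above appear as separate constraints among $k\in\mathcal{E}$, so the number $m$ of equality constraints satisfies $m\ge 2(n-n_G)+n_V$. $\mathcal{P},\mathcal{D}$ denote the feasible sets and $\mathcal{P}^\circ,\mathcal{D}^\circ$ the sets of optimal solutions of (P), (D). For $X\in\mathcal{P}$, $\mathcal{A}(X):=\{k\in\mathcal{I} : A_k\bullet X=b_k\}$ and $a(X):=|\mathcal{A}(X)|$. Slater condition: there is $X\in\mathcal{P}$ with $X\succ 0$ and $A_k\bullet X<b_k$ for all $k\in\mathcal{I}$, and there is $y\in\mathcal{D}$ with $Z(y)\succ 0$ and $y_k>0$ for all $k\in\mathcal{I}$. Strict complementarity for $(X,y)\in\mathcal{P}^\circ\times\mathcal{D}^\circ$: $\operatorname{rank}(X)+\operatorname{rank}(Z(y))=n$. Primal nondegeneracy: let $X\in\mathcal{P}$ have rank $r$ and eigenvalue decomposition $X=Q\Lambda Q^*$ with $Q$ unitary and $\Lambda=\operatorname{diag}(\lambda_1,\dots,\lambda_r,0,\dots,0)$, $\lambda_1,\dots,\lambda_r>0$. Partition $Q=[Q_1\ Q_2]$ with $Q_1\in\mathbb{C}^{n\times r}$, $Q_2\in\mathbb{C}^{n\times(n-r)}$. Then $X$ is primal nondegenerate if and only if the matrices $$B_k^p:=\begin{bmatrix}Q_1^*A_kQ_1 & Q_1^*A_kQ_2\\ Q_2^*A_kQ_1 & 0\end{bmatrix},\qquad k\in\mathcal{E}\cup\mathcal{A}(X),$$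 (as a family indexed by $k$) are linearly independent in $\mathcal{H}^n$. *)

(* Defs.v *)
From HB Require Import structures.
From mathcomp Require Import all_boot all_order all_algebra.
From mathcomp Require Import sesquilinear spectral complex reals.

Set Implicit Arguments.
Unset Strict Implicit.
Unset Printing Implicit Defensive.

Import Order.TTheory GRing.Theory Num.Theory.
Local Open Scope ring_scope.
Local Open Scope complex_scope.
Local Open Scope sesquilinear_scope.

Section HermitianMatrices.
Variable R : realType.

Definition mxdot n (A B : 'M[R[i]]_n) : R[i] :=
  \sum_i \sum_j A i j * ((B i j)^*)%R.

(* The order on R[i] compares only numbers with equal imaginary parts, and
   then compares the real parts; in particular 0 <= z says that z is a
   nonnegative real. *)
Definition possemidef n (A : 'M[R[i]]_n) : Prop :=
  A \is hermsymmx /\ forall v : 'cV[R[i]]_n, 0 <= (v^t* *m A *m v) 0 0.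

Definition posdef n (A : 'M[R[i]]_n) : Prop :=
  A \is hermsymmx /\
  forall v : 'cV[R[i]]_n, v != 0 -> 0 < (v^t* *m A *m v) 0 0.

(* Linear independence over the reals (not over R[i]) of the family of the
   B k, k in K. *)
Definition real_free (I : finType) n (K : {set I}) (B : I -> 'M[R[i]]_n) :
    Prop :=
  forall c : I -> R,
    \sum_(k in K) (c k)%:C *: B k = 0 -> {in K, forall k, c k = 0}.

End HermitianMatrices.

Infix "\bullet" := mxdot (at level 40, no associativity) : ring_scope.

Section IndexSets.
Variables m l : nat.

Definition eq_idx : {set 'I_(m + l)} := [set k : 'I_(m + l) | (k < m)%N].
Definition ineq_idx : {set 'I_(m + l)} := [set k : 'I_(m + l) | (m <= k)%N].

End IndexSets.

Arguments eq_idx {m l}.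
Arguments ineq_idx {m l}.

Record sdp (R : realType) (n m l : nat) := Sdp {
  cost : 'M[R[i]]_n;
  coefs : 'I_(m + l) -> 'M[R[i]]_n;
  rhs : 'cV[R]_(m + l);
  cost_herm : cost \is hermsymmx;
  coefs_herm : forall k, coefs k \is hermsymmx
}.

Section PrimalDual.
Variables (R : realType) (n m l : nat) (p : sdp R n m l).
Implicit Types (X : 'M[R[i]]_n) (y : 'cV[R]_(m + l)).

Let A := coefs p.
Let b := rhs p.

(* For Hermitian arguments \bullet is real-valued, so the comparisons below
   between elements of R[i] are comparisons of real numbers. *)
Definition primal_feasible X : Prop :=
  [/\ {in eq_idx, forall k, A k \bullet X = (b k 0)%:C},
      {in ineq_idx, forall k, A k \bullet X <= (b k 0)%:C}
    & possemidef X].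

Definition dual_slack y : 'M[R[i]]_n :=
  cost p + \sum_k (y k 0)%:C *: A k.

Definition dual_feasible y : Prop :=
  possemidef (dual_slack y) /\ {in ineq_idx, forall k, 0 <= y k 0}.

Definition dual_objective y : R := - (b^T *m y) 0 0.

Definition primal_optimal X : Prop :=
  primal_feasible X /\
  forall X', primal_feasible X' -> cost p \bullet X <= cost p \bullet X'.

Definition dual_optimal y : Prop :=
  dual_feasible y /\
  forall y', dual_feasible y' -> dual_objective y' <= dual_objective y.

Definition active X : {set 'I_(m + l)} :=
  [set k in ineq_idx | A k \bullet X == (b k 0)%:C].

Definition slater : Prop :=
  (exists X, [/\ primal_feasible X, posdef X
               & {in ineq_idx, forall k, A k \bullet X < (b k 0)%:C}]) /\
  (exists y, [/\ dual_feasible y, posdef (dual_slack y)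
               & {in ineq_idx, forall k, 0 < y k 0}]).

Definition strictly_complementary X y : Prop :=
  (\rank X + \rank (dual_slack y))%N = n.

(* unitarymx allows rectangular matrices and only asks that Q Q^* = 1; here
   Q = [Q1 Q2] is square up to the provable equality r + (n - r) = n for
   r = \rank X, so this is unitarity. *)
Definition eigen_decomposition X (Q1 : 'M[R[i]]_(n, \rank X))
    (Q2 : 'M[R[i]]_(n, n - \rank X)) (lambda : 'rV[R]_(\rank X)) : Prop :=
  let Q := row_mx Q1 Q2 in
  let Lambda := block_mx (diag_mx (map_mx (real_complex R) lambda)) 0 0 0 in
  [/\ Q \is unitarymx, forall j, 0 < lambda 0 j
    & X = Q *m Lambda *m Q^t*].

Definition primal_block r s (Q1 : 'M[R[i]]_(n, r)) (Q2 : 'M[R[i]]_(n, s))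
    (k : 'I_(m + l)) : 'M[R[i]]_(r + s) :=
  block_mx (Q1^t* *m A k *m Q1) (Q1^t* *m A k *m Q2)
           (Q2^t* *m A k *m Q1) 0.

(* Changing the decomposition conjugates all the blocks by one
   block-diagonal unitary matrix, so the choice of Q1, Q2 is immaterial. *)
Definition primal_nondegenerate X : Prop :=
  primal_feasible X /\
  exists Q1 Q2 lambda, @eigen_decomposition X Q1 Q2 lambda /\
    real_free (eq_idx :|: active X) (primal_block Q1 Q2).

End PrimalDual.

Record network (R : realType) (n : nat) := Network {
  gen : {set 'I_n};
  fixedV : {set 'I_n};
  admittance : 'M[R[i]]_n;
  demand : 'cV[R[i]]_n;
  Pmin : 'I_n -> R;
  Pmax : 'I_n -> R;
  Qmin : 'I_n -> R;
  Qmax : 'I_n -> R;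
  Vbar : 'I_n -> R
}.

Section OPF.
Variables (R : realType) (n : nat) (N : network R n).

Definition e_ (i : 'I_n) : 'cV[R[i]]_n := delta_mx i 0.

Definition generation (i : 'I_n) (X : 'M[R[i]]_n) : R[i] :=
  demand N i 0 + ((admittance N)^t* *m e_ i *m (e_ i)^T) \bullet X.

Inductive opf_eq :=
  | ReBalance of 'I_n
  | ImBalance of 'I_n
  | FixedVoltage of 'I_n.

Definition opf_eq_present (c : opf_eq) : bool :=
  match c with
  | ReBalance i => i \notin gen N
  | ImBalance i => i \notin gen N
  | FixedVoltage i => i \in fixedV N
  end.

Definition opf_eq_holds (c : opf_eq) (X : 'M[R[i]]_n) : Prop :=
  match c with
  | ReBalance i => complex.Re (generation i X) = 0
  | ImBalance i => complex.Im (generation i X) = 0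
  | FixedVoltage i => (e_ i *m (e_ i)^T) \bullet X = (Vbar N i ^+ 2)%:C
  end.

Section Relaxation.
Variables (m l : nat) (p : sdp R n m l).

(* The k-th constraint of p, read as an equality (resp. an inequality), is
   the constraint E on Hermitian matrices; this leaves free the scaling of
   the pair (A_k, b_k). *)
Definition states_eq (k : 'I_(m + l)) (E : 'M[R[i]]_n -> Prop) : Prop :=
  forall X, X \is hermsymmx ->
    (coefs p k \bullet X = (rhs p k 0)%:C <-> E X).

Definition states_ineq (k : 'I_(m + l)) (E : 'M[R[i]]_n -> Prop) : Prop :=
  forall X, X \is hermsymmx ->
    (coefs p k \bullet X <= (rhs p k 0)%:C <-> E X).

(* The OPF equalities occur at pairwise distinct indices of equality
   constraints; all other constraints, and the cost, are arbitrary. *)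
Definition opf_relaxation : Prop :=
  (exists idx : opf_eq -> 'I_(m + l),
     [/\ {in opf_eq_present, forall c, idx c \in eq_idx},
         {in opf_eq_present &, injective idx}
       & {in opf_eq_present, forall c, states_eq (idx c) (opf_eq_holds c)}]) /\
  {in gen N, forall i,
     [/\ exists2 k, k \in ineq_idx &
           states_ineq k (fun X => Pmin N i <= complex.Re (generation i X)),
         exists2 k, k \in ineq_idx &
           states_ineq k (fun X => complex.Re (generation i X) <= Pmax N i),
         exists2 k, k \in ineq_idx &
           states_ineq k (fun X => Qmin N i <= complex.Im (generation i X))
       & exists2 k, k \in ineq_idx &
           states_ineq k (fun X => complex.Im (generation i X) <= Qmax N i)]}.

End Relaxation.
End OPF.

(* Main.v *)
(* Primal nondegeneracy of an optimal solution X0 of rank r bounds the number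
   m + a(X0) of independent constraints by the dimension 2nr - r^2 of the space
   of Hermitian matrices with vanishing lower right block, which is at most
   2n - 1 when r <= 1; the power balance and voltage equalities already give
   m >= 2(n - n_G) + n_V, so the assumption on n_G forces r > 1.  All optimal
   solutions have the rank of X0: strict complementarity against one and the
   same dual optimum y makes that rank n - rank Z(y).  A dual optimum exists
   because the superlevel sets of the dual objective are compact: pairing Z(y)
   with a strictly feasible X bounds tr Z(y) and the multipliers of the
   inequalities, and then independence of the A_k bounds those of the
   equalities. *)

From HB Require Import structures.
Require Import Defs.
From mathcomp Require Import boolp classical_sets topology normedtype derive.
From mathcomp Require Import all_boot all_order all_algebra.
From mathcomp Require Import complex reals.
From mathcomp Require Import sesquilinear spectral ring lra zify.

Set Implicit Arguments.
Unset Strict Implicit.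
Unset Printing Implicit Defensive.

Import Order.TTheory GRing.Theory Num.Theory numFieldNormedType.Exports.
Local Open Scope ring_scope.
Local Open Scope complex_scope.
Local Open Scope sesquilinear_scope.

(** * Real and imaginary parts, and entries of Hermitian matrices *)

Section ComplexParts.
Variable R : realType.
Implicit Types (c : R) (z : R[i]).

Lemma Re_is_zmod_morphism : zmod_morphism (@complex.Re R : R[i] -> R).
Proof. by case=> a b [c d]. Qed.

Lemma Im_is_zmod_morphism : zmod_morphism (@complex.Im R : R[i] -> R).
Proof. by case=> a b [c d]. Qed.

HB.instance Definition _ :=
  GRing.isZmodMorphism.Build R[i] R (@complex.Re R) Re_is_zmod_morphism.
HB.instance Definition _ :=
  GRing.isZmodMorphism.Build R[i] R (@complex.Im R) Im_is_zmod_morphism.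

Lemma ReZ c z : complex.Re (c%:C * z) = c * complex.Re z.
Proof. by case: z => a b /=; rewrite mul0r subr0. Qed.

Lemma ImZ c z : complex.Im (c%:C * z) = c * complex.Im z.
Proof. by case: z => a b /=; rewrite mul0r addr0. Qed.

Lemma normc_ge_Im z : `|complex.Im z|%:C <= `|z|.
Proof.
by case: z => a b; simpc; rewrite -sqrtr_sqr ler_wsqrtr // lerDr sqr_ge0.
Qed.

Lemma conj_Im z : complex.Im (z^*)%R = - complex.Im z.
Proof. by case: z. Qed.

Lemma complex_eq0 z : complex.Re z = 0 -> complex.Im z = 0 -> z = 0.
Proof. by case: z => a b /= -> ->. Qed.

Lemma hermitian_entry n (A : 'M[R[i]]_n) : A \is hermsymmx ->
  forall i j, A j i = ((A i j)^*)%R.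
Proof.
by move=> /is_hermitianmxP; rewrite expr0 scale1r => {1}-> i j; rewrite !mxE.
Qed.

Lemma hermitian_adjoint n (A : 'M[R[i]]_n) : A \is hermsymmx -> A^t* = A.
Proof. by move=> /is_hermitianmxP; rewrite expr0 scale1r => {2}->. Qed.

Lemma adjoint_hermitian n (A : 'M[R[i]]_n) : A^t* = A -> A \is hermsymmx.
Proof. by move=> AE; apply/is_hermitianmxP; rewrite expr0 scale1r AE. Qed.

Lemma hermitian_real_comb n (I : finType) (K : {set I}) (c : I -> R)
    (B : I -> 'M[R[i]]_n) : (forall k, B k \is hermsymmx) ->
  \sum_(k in K) (c k)%:C *: B k \is hermsymmx.
Proof.
move=> Bh; apply: adjoint_hermitian; apply/matrixP => i j.
rewrite !mxE !summxE rmorph_sum; apply: eq_bigr => k _.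
by rewrite !mxE rmorphM /= (hermitian_entry (Bh k) i j) conjCK conj_Creal //
  complex_real.
Qed.

End ComplexParts.

(** * Counting and bounding coefficients of real-independent families *)

Section RealFreeFamilies.
Variables (R : realType) (I T : finType) (n : nat) (K : {set I}).
Variables (B : I -> 'M[R[i]]_n) (f : T -> 'M[R[i]]_n -> R).
(** Linearity and joint injectivity of the [f t] are asked only on the span of the [B k], so that a
    small coordinate set adapted to that span can be used. *)
Hypothesis f_comb : forall t (c : I -> R),
  f t (\sum_(k in K) (c k)%:C *: B k) = \sum_(k in K) c k * f t (B k).
Hypothesis f_inj : forall c : I -> R,
  (forall t, f t (\sum_(k in K) (c k)%:C *: B k) = 0) ->
  \sum_(k in K) (c k)%:C *: B k = 0.
Hypothesis B_free : real_free K B.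

Definition coord_mx : 'M[R]_(#|K|, #|T|) :=
  \matrix_(a, t) f (enum_val t) (B (enum_val a)).

Lemma mul_coord_mx (c : I -> R) :
  (\row_(a < #|K|) c (enum_val a)) *m coord_mx =
  \row_t f (enum_val t) (\sum_(k in K) (c k)%:C *: B k).
Proof.
apply/rowP => t; rewrite !mxE f_comb [in RHS]big_enum_val /=.
by apply: eq_bigr => a _; rewrite !mxE.
Qed.

Lemma coord_mx_free : row_free coord_mx.
Proof.
rewrite -kermx_eq0; apply/rowV0P => u /sub_kermxP u0.
(* Carries [u], indexed by positions in [K], to a function on [I] that vanishes off [K]. *)
pose c k := \sum_(a | enum_val a == k) u 0 a.
have cE : u = \row_(a < #|K|) c (enum_val a).
  apply/rowP => a; rewrite mxE /c (big_pred1 a) // => a'.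
  exact/(inj_eq enum_val_inj).
suff c0 : {in K, forall k, c k = 0}.
  by rewrite cE; apply/rowP => a; rewrite !mxE c0 ?enum_valP.
apply/B_free/f_inj => t; move: u0; rewrite cE mul_coord_mx => /rowP.
by move=> /(_ (enum_rank t)); rewrite !mxE enum_rankK.
Qed.

Lemma card_real_free : (#|K| <= #|T|)%N.
Proof. by have := rank_leq_col coord_mx; rewrite (eqP coord_mx_free). Qed.

(** Full row rank makes [pinvmx coord_mx] a right inverse, which recovers the coefficients from the
    coordinates; summing the moduli of all its entries gives one constant for every [k] and [c]. *)
Lemma real_free_bound : exists M : R, 0 <= M /\
  forall (c : I -> R) (w : R),
    (forall t, `|f t (\sum_(k in K) (c k)%:C *: B k)| <= w) ->
  {in K, forall k, `|c k| <= M * w}.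
Proof.
pose P := pinvmx coord_mx.
exists (\sum_t \sum_a `|P t a|); split=> [|c w fw k kK].
  by apply: sumr_ge0 => t _; apply: sumr_ge0.
pose a := enum_rank_in kK k.
have -> : c k = ((\row_(a < #|K|) c (enum_val a)) *m coord_mx *m P) 0 a.
  by rewrite -mulmxA mulmxVp ?coord_mx_free // mulmx1 mxE enum_rankK_in.
rewrite mul_coord_mx mxE mulr_suml (le_trans (ler_norm_sum _ _ _)) //.
apply: ler_sum => t _; rewrite mxE normrM mulrC ler_pM //.
by rewrite (bigD1 a) //= lerDl sumr_ge0.
Qed.

End RealFreeFamilies.

(** * Real coordinates, and Hermitian matrices with zero lower right block *)

Section Coordinates.
Variable R : realType.

Definition ReIm_coord n (t : bool * ('I_n * 'I_n)) (A : 'M[R[i]]_n) : R :=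
  let z := A t.2.1 t.2.2 in if t.1 then complex.Re z else complex.Im z.

Lemma ReIm_coord_comb n (I : finType) (K : {set I}) (c : I -> R)
    (B : I -> 'M[R[i]]_n) t :
  ReIm_coord t (\sum_(k in K) (c k)%:C *: B k) =
    \sum_(k in K) c k * ReIm_coord t (B k).
Proof.
rewrite /ReIm_coord summxE !raddf_sum /=; case: t.1; apply: eq_bigr => k _;
  by rewrite !mxE ?ReZ ?ImZ.
Qed.

Lemma ReIm_coordD n t (A B : 'M[R[i]]_n) :
  ReIm_coord t (A + B) = ReIm_coord t A + ReIm_coord t B.
Proof. by rewrite /ReIm_coord mxE !raddfD; case: t.1. Qed.

Lemma ReIm_coord_eq0 n (A : 'M[R[i]]_n) :
  (forall t, ReIm_coord t A = 0) -> A = 0.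
Proof.
move=> A0; apply/matrixP => i j; rewrite mxE.
by apply: complex_eq0; [apply: (A0 (true, (i, j)))|apply: (A0 (false, (i, j)))].
Qed.

(* The real parts on and above the diagonal of a Hermitian matrix, together with
   its imaginary parts below the diagonal, determine it. *)
Definition arrow_coord_at r s (t : ('I_r * 'I_r) + bool * ('I_r * 'I_s)) :
    bool * ('I_(r + s) * 'I_(r + s)) :=
  match t with
  | inl (i, j) => ((i <= j)%N, (lshift s i, lshift s j))
  | inr (b, (i, j)) => (b, (lshift s i, rshift r j))
  end.

(** The upper left block carries r^2 coordinates and the upper right block 2rs; the lower left block
    is the adjoint of the upper right one, so nothing else is free. *)
Lemma card_real_free_arrow (I : finType) r s (K : {set I})
    (B : I -> 'M[R[i]]_(r + s)) :
  (forall k, B k \is hermsymmx) -> (forall k, drsubmx (B k) = 0) ->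
  real_free K B -> (#|K| <= r * r + 2 * (r * s))%N.
Proof.
move=> Bh B0 Bfree.
have -> : (r * r + 2 * (r * s) = #|{: ('I_r * 'I_r) + bool * ('I_r * 'I_s)}|)%N.
  by rewrite card_sum !card_prod card_bool !card_ord.
apply: (@card_real_free _ _ _ _ K B
  (fun t => ReIm_coord (arrow_coord_at t))) => //.
  by move=> t c; rewrite ReIm_coord_comb.
move=> c; set W := \sum_(k in K) _ => W0.
have Wh : W \is hermsymmx by apply: hermitian_real_comb.
have Wdr : drsubmx W = 0.
  apply/matrixP => i j; rewrite /W !mxE summxE big1 // => k _.
  by have /matrixP/(_ i j) := B0 k; rewrite !mxE => ->; rewrite mulr0.
have Wur i j : W (lshift s i) (rshift r j) = 0.
  by apply: complex_eq0;
    [apply: (W0 (inr (true, (i, j))))|apply: (W0 (inr (false, (i, j))))].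
have Wul i j : W (lshift s i) (lshift s j) = 0.
  wlog le_ij : i j / (i <= j)%N => [hw|].
    have [/hw //|/ltnW/hw ji] := leqP i j.
    by rewrite (hermitian_entry Wh (lshift s j)) ji conjC0.
  have := W0 (inl (i, j)); rewrite /ReIm_coord /= le_ij => Re0.
  apply: complex_eq0 => //.
  move: le_ij; rewrite leq_eqVlt => /orP[/eqP/val_inj ij|lt_ij].
    (* A diagonal entry equals its own conjugate, so its imaginary part is its own negative. *)
    rewrite ij in Re0 *; have := hermitian_entry Wh (lshift s j) (lshift s j).
    by move=> /(congr1 (@complex.Im R)); rewrite conj_Im => ?; lra.
  (* Above the diagonal, the imaginary part is minus the one recorded at the mirrored position. *)
  have := W0 (inl (j, i)); rewrite /ReIm_coord /= leqNgt lt_ij /=.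
  rewrite (hermitian_entry Wh (lshift s i)) conj_Im => /eqP.
  by rewrite oppr_eq0 => /eqP.
apply/matrixP => i j; rewrite mxE.
case: (split_ordP i) => i' ->; case: (split_ordP j) => j' -> //.
  by rewrite (hermitian_entry Wh (lshift s j')) Wur conjC0.
by have /matrixP/(_ i' j') := Wdr; rewrite !mxE.
Qed.

End Coordinates.

(** * Positive semidefinite matrices: entry and trace bounds *)

Lemma phase_exists (C : numClosedFieldType) (z : C) :
  exists2 w : C, w * z = `|z| & w * w^* = 1.
Proof.
have [->|z0] := eqVneq z 0.
  by exists 1; rewrite ?normr0 ?mulr0 // conjC1 mulr1.
have nz0 : `|z| != 0 by rewrite normr_eq0.
exists (z^* / `|z|).
  by rewrite mulrAC -[X in X / _]mulrC -normCK expr2 mulfK.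
by rewrite -normCK normrM normfV normr_id norm_conjC divff // expr1n.
Qed.

Section SemidefiniteMatrices.
Variables (R : realType) (n : nat).
Implicit Types (A B X Z : 'M[R[i]]_n).

Lemma mxdotE A B : A \bullet B = \tr (A *m B^t*).
Proof.
apply: eq_bigr => i _; rewrite mxE; apply: eq_bigr => j _.
by rewrite !mxE.
Qed.

Lemma quad_diag Z m (P : 'M[R[i]]_(m, n)) i :
  (P *m Z *m P^t*) i i = ((row i P)^t*^t* *m Z *m (row i P)^t*) 0 0.
Proof.
by rewrite trmxCK -2!row_mul !mxE; apply: eq_bigr => j _; rewrite !mxE.
Qed.

Lemma psd_conj_diag_ge0 Z m (P : 'M[R[i]]_(m, n)) i :
  possemidef Z -> 0 <= (P *m Z *m P^t*) i i.
Proof. by move=> [_ Zpos]; rewrite quad_diag; apply: Zpos. Qed.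

Lemma psd_diag_ge0 Z i : possemidef Z -> 0 <= Z i i.
Proof.
by move=> /(psd_conj_diag_ge0 1%:M i); rewrite mul1mx trmx1 map_mx1 mulmx1.
Qed.

Lemma psd_trace_ge0 Z : possemidef Z -> 0 <= \tr Z.
Proof. by move=> Zpsd; apply: sumr_ge0 => i _; apply: psd_diag_ge0. Qed.

(** Turns a trace bound on a dual slack into a bound on all its real coordinates. *)
Lemma psd_entry_le_trace Z i j : possemidef Z -> `|Z i j| <= \tr Z.
Proof.
move=> Zpsd; have Zd k := psd_diag_ge0 k Zpsd.
have [<-|ij] := eqVneq i j.
  by rewrite ger0_norm // /mxtrace (bigD1 i) //= lerDl sumr_ge0.
have le_tr : Z i i + Z j j <= \tr Z.
  rewrite /mxtrace (bigD1 i) //= lerD2l (bigD1 j) 1?eq_sym //= lerDl.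
  exact: sumr_ge0.
(* The quadratic form at [e_i - w e_j], where [w * Z i j] is the modulus of
   [Z i j], equals [Z i i + Z j j - 2 |Z i j|]. *)
have [w wz ww] := phase_exists (Z i j).
have wz' : (w^*)%R * Z j i = `|Z i j|.
  by rewrite (hermitian_entry Zpsd.1 i j) -rmorphM wz; apply: geC0_conj.
have : 0 <= Z i i + Z j j - 2 * `|Z i j|.
  have [Zh /(_ (delta_mx i 0 - w *: delta_mx j 0))] := Zpsd.
  have -> : (delta_mx i 0 - w *: delta_mx j 0 : 'cV[R[i]]_n)^t* =
      delta_mx 0 i - (w^*)%R *: delta_mx 0 j.
    apply/rowP => k; rewrite !mxE /= rmorphB rmorphM /=.
    by rewrite !conjC_nat !andbT.
  rewrite !(mulmxBl, mulmxBr) -!scalemxAl -!scalemxAr -!rowE -!colE !mxE.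
  rewrite [(w^*)%R * (w * _)]mulrA [(w^*)%R * w]mulrC ww mul1r wz wz'.
  by congr (0 <= _); ring.
rewrite subr_ge0 => le2.
rewrite -(ler_pM2l (ltr0Sn _ 1)) (le_trans le2) // (le_trans le_tr) //.
by rewrite mulr_natl mulr2n lerDl psd_trace_ge0.
Qed.

(** In an orthonormal eigenbasis of [X], the trace of [Z] is the sum of its nonnegative diagonal
    entries, and [Z \bullet X] is the same sum weighted by the eigenvalues of [X]; any positive
    lower bound on these eigenvalues serves as [c]. *)
Lemma posdef_trace_bound X : posdef X -> exists2 c : R, 0 < c &
  forall Z, possemidef Z -> c%:C * \tr Z <= Z \bullet X.
Proof.
move=> [Xh Xpos].
have /orthomx_spectralP := hermitian_normalmx Xh.
set P := spectralmx X; set D := spectral_diag X => XE.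
have Pu : P \is unitarymx := spectral_unitarymx X.
have PX : P *m X *m P^t* = diag_mx D.
  by rewrite {1}XE invmx_unitary // !mulmxA (unitarymxP Pu) mul1mx mulmxtVK.
have Dreal i : D 0 i = (complex.Re (D 0 i))%:C.
  by rewrite RRe_real //; apply: (mxOverP (hermitian_spectral_diag_real Xh)).
have Dpos i : 0 < complex.Re (D 0 i).
  rewrite -ltcR -Dreal.
  have -> : D 0 i = (P *m X *m P^t*) i i by rewrite PX mxE eqxx.
  rewrite quad_diag; apply: Xpos.
  (* A row of a unitary matrix has norm one, hence is nonzero. *)
  apply/eqP => Pi0; have /matrixP/(_ i i)/eqP := unitarymxP Pu.
  rewrite mxE [X in X == _]big1 => [|k _].
    by rewrite mxE eqxx eq_sym oner_eq0.
  by have /colP/(_ k) := Pi0; rewrite !mxE => ->; rewrite mulr0.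
(* The default 1 keeps the minimum positive even for [n = 0]; capping at 1 is harmless for a lower
   bound. *)
exists (\big[Num.min/1]_i complex.Re (D 0 i)) => [|Z Zpsd].
  by apply/bigmin_gtP.
set c := \big[_/_]_i _.
have -> : \tr Z = \tr (P *m Z *m P^t*).
  by rewrite mxtrace_mulC mulmxA -[P^t*]invmx_unitary // mulVmx ?mul1mx
    ?unitarymx_unit.
have -> : Z \bullet X = \sum_i (P *m Z *m P^t*) i i * D 0 i.
  rewrite mxdotE (hermitian_adjoint Xh) {1}XE invmx_unitary // !mulmxA.
  rewrite mxtrace_mulC !mulmxA.
  by apply: eq_bigr => i _; rewrite mul_mx_diag mxE.
rewrite mulr_sumr; apply: ler_sum => i _; rewrite mulrC ler_wpM2l //.
  exact: psd_conj_diag_ge0.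
by rewrite Dreal lecR bigmin_le.
Qed.

End SemidefiniteMatrices.

(** * Compactness of dual level sets and existence of a dual optimum *)

Section DualAttainment.
Local Open Scope classical_set_scope.
Variables (R : realType) (n m l : nat) (p : sdp R n m l).
Implicit Types (X Z : 'M[R[i]]_n) (y : 'cV[R]_(m + l)).

Lemma ineq_idxE (k : 'I_(m + l)) : (k \in ineq_idx) = (k \notin eq_idx).
Proof. by rewrite !inE -leqNgt. Qed.

Lemma Re_dual_slack_dot y X : complex.Re (dual_slack p y \bullet X) =
  complex.Re (cost p \bullet X) +
    \sum_k y k 0 * complex.Re (coefs p k \bullet X).
Proof.
rewrite !mxdotE /dual_slack mulmxDl mulmx_suml linearD /= linear_sum /=.
rewrite raddfD /=; congr (_ + _).
rewrite raddf_sum; apply: eq_bigr => k _.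
by rewrite /= -scalemxAl mxtraceZ ReZ -mxdotE.
Qed.

Lemma dual_slack_herm y : dual_slack p y \is hermsymmx.
Proof.
rewrite /dual_slack; apply: adjoint_hermitian; rewrite linearD /= map_mxD.
rewrite hermitian_adjoint ?cost_herm //; congr (_ + _).
rewrite -(eq_bigl _ _ (@in_setT _)); apply: hermitian_adjoint.
apply: hermitian_real_comb; exact: coefs_herm.
Qed.

Lemma dual_objectiveE y : dual_objective p y = - \sum_k y k 0 * rhs p k 0.
Proof.
rewrite /dual_objective mxE; congr (- _); apply: eq_bigr => k _.
by rewrite mxE mulrC.
Qed.

Lemma quad_mxdot Z (v : 'cV[R[i]]_n) :
  (v^t* *m Z *m v) 0 0 = Z \bullet (v *m v^t*).
Proof.
rewrite mxdotE trmx_mul map_mxM /= trmxCK mulmxA mxtrace_mulC mulmxA.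
by rewrite /mxtrace big_ord1.
Qed.

(** Each test vector contributes one affine inequality in [y], which exhibits semidefiniteness of
    the slack as an intersection of closed half-spaces. Real parts suffice because the slack is
    Hermitian for every [y]. *)
Lemma dual_slack_psdP y : possemidef (dual_slack p y) <->
  forall v : 'cV[R[i]]_n, 0 <= complex.Re (dual_slack p y \bullet (v *m v^t*)).
Proof.
split=> [[_ Zpos] v|Zpos].
  by have := Zpos v; rewrite quad_mxdot lecE => /andP[].
split=> [|v]; first exact: dual_slack_herm.
have qreal : (v^t* *m dual_slack p y *m v)^t* = v^t* *m dual_slack p y *m v.
  rewrite !trmx_mul !map_mxM /= trmxCK (hermitian_adjoint (dual_slack_herm y)).
  exact: mulmxA.
rewrite lecE {2}quad_mxdot Zpos andbT.
move: qreal => /matrixP/(_ 0 0); rewrite [LHS]mxE mxE.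
by move=> /(congr1 (@complex.Im R)); rewrite conj_Im => ?; apply/eqP; lra.
Qed.

Lemma dual_level_bounded Xhat t :
    primal_feasible p Xhat -> posdef Xhat ->
    {in ineq_idx, forall k, coefs p k \bullet Xhat < (rhs p k 0)%:C} ->
    real_free eq_idx (coefs p) ->
  exists M : R, forall y, dual_feasible p y -> t <= dual_objective p y ->
    forall k, `|y k 0| <= M.
Proof.
move=> [Xeq _ _] Xpd Xineq Afree.
have [c c_gt0 trX] := posdef_trace_bound Xpd.
pose s k := rhs p k 0 - complex.Re (coefs p k \bullet Xhat).
have s_eq k : k \in eq_idx -> s k = 0 by move=> kE; rewrite /s Xeq // subrr.
have s_gt0 k : k \in ineq_idx -> 0 < s k.
  by move=> kI; have := Xineq k kI; rewrite ltcE subr_gt0 => /andP[].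
(* An upper bound for the duality gap between [Xhat] and any [y] of the level set. *)
pose gap := complex.Re (cost p \bullet Xhat) - t.
have [M [M_ge0 AM]] := real_free_bound
  (fun u c => ReIm_coord_comb eq_idx c (coefs p) u)
  (fun c => @ReIm_coord_eq0 _ _ _) Afree.
pose S (A : 'M[R[i]]_n) := \sum_u `|ReIm_coord u A|.
(* The equality part of the slack is [Z] minus the cost minus the inequality part; the three
   summands of [w] bound the coordinates of these in turn. *)
pose w := gap / c + S (cost p) + \sum_(k in ineq_idx) gap / s k * S (coefs p k).
exists (M * w + \sum_(k in ineq_idx) gap / s k) => y [Zpsd y_ge0] ty.
set Z := dual_slack p y in Zpsd.
(* The left side is exactly the cost of [Xhat] minus the dual objective at [y]. Both of its terms
   are nonnegative, so each is at most [gap]. *)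
have gapE :
    complex.Re (Z \bullet Xhat) + \sum_(k in ineq_idx) y k 0 * s k <= gap.
  rewrite Re_dual_slack_dot -addrA lerD2l.
  rewrite dual_objectiveE in ty.
  suff <- : \sum_k y k 0 * rhs p k 0 =
      \sum_k y k 0 * complex.Re (coefs p k \bullet Xhat) +
      \sum_(k in ineq_idx) y k 0 * s k by lra.
  rewrite [X in _ + X]big_mkcond -big_split; apply: eq_bigr => k _ /=.
  rewrite ineq_idxE.
  have [kE|_] /= := boolP (k \in eq_idx); rewrite -?mulrDr /s ?subrKC //.
  by have := s_eq k kE; rewrite /s addr0 => /eqP; rewrite subr_eq0 => /eqP ->.
have trZ : c * complex.Re (\tr Z) <= complex.Re (Z \bullet Xhat).
  by have := trX Z Zpsd; rewrite lecE ReZ => /andP[].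
have trZ_ge0 : 0 <= complex.Re (\tr Z).
  by have := psd_trace_ge0 Zpsd; rewrite lecE => /andP[].
have ys_ge0 k : k \in ineq_idx -> 0 <= y k 0 * s k.
  by move=> kI; rewrite mulr_ge0 ?y_ge0 // ltW ?s_gt0.
have sum_ge0 : 0 <= \sum_(k in ineq_idx) y k 0 * s k by apply: sumr_ge0.
have ctrZ_ge0 : 0 <= c * complex.Re (\tr Z) by rewrite mulr_ge0 // ltW.
have gap_ge0 : 0 <= gap by lra.
have y_le k : k \in ineq_idx -> y k 0 <= gap / s k.
  move=> kI; rewrite ler_pdivlMr ?s_gt0 //.
  rewrite (bigD1 k) //= in gapE sum_ge0.
  have : 0 <= \sum_(i in ineq_idx | i != k) y i 0 * s i.
    by apply: sumr_ge0 => i /andP[/ys_ge0].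
  by lra.
have gs_ge0 k : k \in ineq_idx -> 0 <= gap / s k.
  by move=> kI; rewrite divr_ge0 // ltW ?s_gt0.
have S_ge u A : `|ReIm_coord u A| <= S A.
  by rewrite /S (bigD1 u) //= lerDl sumr_ge0.
have Zu u : `|ReIm_coord u Z| <= gap / c.
  have ZuC : `|ReIm_coord u Z|%:C <= \tr Z.
    apply: le_trans (psd_entry_le_trace u.2.1 u.2.2 Zpsd); rewrite /ReIm_coord.
    by case: u.1; [apply: normc_ge_Re|apply: normc_ge_Im].
  rewrite ler_pdivlMr // mulrC.
  apply: le_trans (_ : c * complex.Re (\tr Z) <= _); last by lra.
  by rewrite ler_pM2l //; move: ZuC; rewrite lecE => /andP[].
have wE u : `|ReIm_coord u (\sum_(k in eq_idx) (y k 0)%:C *: coefs p k)| <= w.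
  have ZE : ReIm_coord u Z = ReIm_coord u (cost p) +
      (ReIm_coord u (\sum_(k in eq_idx) (y k 0)%:C *: coefs p k) +
       \sum_(k in ineq_idx) y k 0 * ReIm_coord u (coefs p k)).
    rewrite /Z /dual_slack ReIm_coordD -(eq_bigl _ _ (@in_setT _)).
    rewrite !ReIm_coord_comb; congr (_ + _).
    rewrite (eq_bigl _ _ (@in_setT _)) (bigID (mem eq_idx)) /=; congr (_ + _).
    by apply: eq_bigl => k; rewrite ineq_idxE.
  have -> : ReIm_coord u (\sum_(k in eq_idx) (y k 0)%:C *: coefs p k) =
      ReIm_coord u Z - ReIm_coord u (cost p) -
      \sum_(k in ineq_idx) y k 0 * ReIm_coord u (coefs p k) by rewrite ZE; ring.
  rewrite (le_trans (ler_normB _ _)) // lerD //.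
    by rewrite (le_trans (ler_normB _ _)) // lerD.
  rewrite (le_trans (ler_norm_sum _ _ _)) //; apply: ler_sum => k kI.
  by rewrite normrM ler_pM // ger0_norm ?y_ge0 ?y_le.
have sumg_ge0 : 0 <= \sum_(k in ineq_idx) gap / s k by apply: sumr_ge0.
move=> k; have [kE|kI] := boolP (k \in eq_idx).
  by apply: le_trans (AM _ _ wE k kE) _; rewrite lerDl.
rewrite -ineq_idxE in kI; rewrite ger0_norm ?y_ge0 // (le_trans (y_le k kI)) //.
rewrite (bigD1 k) //= addrCA lerDl addr_ge0 //.
  rewrite mulr_ge0 // /w !addr_ge0 ?divr_ge0 ?(ltW c_gt0) //.
    exact: sumr_ge0.
  by apply: sumr_ge0 => i iI; rewrite mulr_ge0 ?gs_ge0 // sumr_ge0.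
by apply: sumr_ge0 => i /andP[/gs_ge0].
Qed.

Lemma affine_continuous d (a : R) (c : 'I_d -> R) :
  continuous (fun v : 'rV[R]_d => a + \sum_k v 0 k * c k).
Proof.
have sum_cont (ks : seq 'I_d) :
    continuous (fun v : 'rV[R]_d => \sum_(k <- ks) v 0 k * c k).
  elim: ks => [|k ks IH].
    rewrite (_ : (fun _ => _) = fun=> 0); first exact: cst_continuous.
    by apply: funext => v; rewrite big_nil.
  rewrite (_ : (fun _ => _) =
    (fun v : 'rV[R]_d => v 0 k * c k + \sum_(j <- ks) v 0 j * c j)); last first.
    by apply: funext => v; rewrite big_cons.
  move=> v.
  apply: (@continuousD _ _ _ (fun w : 'rV[R]_d => w 0 k * c k)) (IH v).
  apply: (@continuousM _ _ (fun w : 'rV[R]_d => w 0 k) (fun=> c k)).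
    exact: coord_continuous.
  exact: cst_continuous.
move=> v; apply: (@continuousD _ _ _ (fun=> a)) (sum_cont _ v).
exact: cst_continuous.
Qed.

Lemma affine_nonneg_closed d (a : R) (c : 'I_d -> R) :
  topology_structure.closed [set v : 'rV[R]_d | 0 <= a + \sum_k v 0 k * c k].
Proof.
apply: (@closed_comp _ _ (fun v : 'rV[R]_d => a + \sum_k v 0 k * c k)
  [set x | 0 <= x]); last exact: closed_ge.
by move=> v _; apply: affine_continuous.
Qed.

(** An intersection of half-spaces: one per test vector, one per inequality multiplier, one for the
    objective. Row vectors are used to match [rV_compact] and [EVT_max_rV]. *)
Lemma dual_level_closed t :
  topology_structure.closed [set v : 'rV[R]_(m + l) |
    dual_feasible p v^T /\ t <= dual_objective p v^T].
Proof.
pose pos a (c : 'I_(m + l) -> R) :=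
  [set v : 'rV[R]_(m + l) | 0 <= a + \sum_k v 0 k * c k].
suff -> : [set v : 'rV[R]_(m + l) |
    dual_feasible p v^T /\ t <= dual_objective p v^T] =
  \bigcap_(u : 'cV[R[i]]_n) pos (complex.Re (cost p \bullet (u *m u^t*)))
      (fun k => complex.Re (coefs p k \bullet (u *m u^t*))) `&`
  \bigcap_(k in [set` ineq_idx]) pos 0 (fun j => (j == k)%:R) `&`
  pos (- t) (fun k => - rhs p k 0).
  apply: closedI; last exact: affine_nonneg_closed.
  by apply: closedI; apply: closed_bigI => ? _; apply: affine_nonneg_closed.
have trE (v : 'rV[R]_(m + l)) (c : 'I_(m + l) -> R) :
    \sum_k v^T k 0 * c k = \sum_k v 0 k * c k.
  by apply: eq_bigr => k _; rewrite mxE.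
have objE (v : 'rV[R]_(m + l)) :
    (t <= dual_objective p v^T) = (0 <= - t + \sum_k v 0 k * - rhs p k 0).
  rewrite dual_objectiveE trE addrC subr_ge0 -sumrN.
  by congr (_ <= _); apply: eq_bigr => k _; rewrite mulrN.
have coordE (v : 'rV[R]_(m + l)) k :
    0 + \sum_j v 0 j * (j == k)%:R = v^T k 0.
  rewrite add0r (bigD1 k) //= eqxx mulr1 mxE big1 ?addr0 // => j /negbTE ->.
  by rewrite mulr0.
apply/seteqP; split=> v /=.
  move=> [[/dual_slack_psdP Zpos y_ge0] tv].
  split; last by rewrite /pos /= -objE.
  split=> [u _|k kI]; rewrite /pos /=; first by rewrite -trE -Re_dual_slack_dot.
  by rewrite coordE; apply: y_ge0.
move=> [[Zpos y_ge0] tv]; split; last by rewrite objE.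
split=> [|k kI]; last by rewrite -coordE; apply: y_ge0.
apply/dual_slack_psdP => u; rewrite Re_dual_slack_dot trE; exact: Zpos.
Qed.

Lemma dual_optimum_exists Xhat y0 :
    primal_feasible p Xhat -> posdef Xhat ->
    {in ineq_idx, forall k, coefs p k \bullet Xhat < (rhs p k 0)%:C} ->
    real_free eq_idx (coefs p) -> dual_feasible p y0 ->
  exists y, dual_optimal p y.
Proof.
move=> Xfeas Xpd Xineq Afree y0feas; pose t := dual_objective p y0.
have [M yM] := dual_level_bounded t Xfeas Xpd Xineq Afree.
set L := [set v : 'rV[R]_(m + l) |
  dual_feasible p v^T /\ t <= dual_objective p v^T].
have Lcompact : compact L.
  apply: (@subclosed_compact _ L
    [set v : 'rV[R]_(m + l) | forall k, `[- M, M]%classic (v ord0 k)]).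
  - exact: dual_level_closed.
  - apply: (@rV_compact _ _ (fun=> `[- M, M]%classic)) => k.
    exact: segment_compact.
  - move=> v [vfeas vt] k; rewrite /= in_itv /= -ler_norml.
    by have := yM _ vfeas vt k; rewrite mxE.
have L0 : L !=set0 by exists y0^T; rewrite /L /= trmxK.
have objc : continuous (fun v : 'rV[R]_(m + l) => dual_objective p v^T).
  have -> : (fun v : 'rV[R]_(m + l) => dual_objective p v^T) =
      (fun v => 0 + \sum_k v 0 k * - rhs p k 0).
    apply: funext => v; rewrite dual_objectiveE add0r -sumrN.
    by apply: eq_bigr => k _; rewrite mxE mulrN.
  exact: affine_continuous.
have [v /set_mem [vfeas vt] vmax] :=
  EVT_max_rV L0 Lcompact (continuous_subspaceT objc).
exists v^T; split=> // y yfeas.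
(* A competitor below level [t] lies outside [L], but the maximiser already has value at least
   [t]. *)
have [le_ty|lt_yt] := leP t (dual_objective p y); last first.
  exact: le_trans (ltW lt_yt) vt.
by have := vmax y^T; rewrite trmxK; apply; apply/mem_set; rewrite /L /= trmxK.
Qed.

End DualAttainment.

(** * Counting constraints, and the rank bound *)

Lemma primal_block_herm (R : realType) (n m l r s : nat) (p : sdp R n m l)
    (Q1 : 'M[R[i]]_(n, r)) (Q2 : 'M[R[i]]_(n, s)) k :
  primal_block p Q1 Q2 k \is hermsymmx.
Proof.
have cong u v (P : 'M[R[i]]_(n, u)) (Q : 'M[R[i]]_(n, v)) :
    (P^t* *m coefs p k *m Q)^t* = Q^t* *m coefs p k *m P.
  rewrite !trmx_mul !map_mxM /= trmxCK mulmxA.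
  by rewrite (hermitian_adjoint (coefs_herm p k)).
apply: adjoint_hermitian.
by rewrite /primal_block tr_block_mx map_block_mx !cong trmx0 map_mx0.
Qed.

Lemma card_primal_nondegenerate (R : realType) (n m l : nat) (p : sdp R n m l)
    (X : 'M[R[i]]_n) : primal_nondegenerate p X ->
  (#|@eq_idx m l| + #|active p X| <=
     \rank X * \rank X + 2 * (\rank X * (n - \rank X)))%N.
Proof.
move=> [_ [Q1 [Q2 [lambda [_ Bfree]]]]].
have /card_real_free_arrow := Bfree.
(* Active constraints are inequalities, so the union with the equalities is disjoint and the
   cardinals add. *)
rewrite cardsU disjoint_setI0 ?cards0 ?subn0.
  apply=> k; [exact: primal_block_herm|by rewrite block_mxKdr].
rewrite disjoint_subset; apply/subsetP => k kE; rewrite !inE in kE *.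
by rewrite leqNgt kE.
Qed.

(** As [idx] is injective only on the constraints present, the three families are counted through
    their images, which are pairwise disjoint because their constructors differ. *)
Lemma card_opf_eq (R : realType) (n m l : nat) (N : network R n)
    (p : sdp R n m l) : opf_relaxation N p ->
  (2 * (n - #|gen N|) + #|fixedV N| <= #|@eq_idx m l|)%N.
Proof.
move=> [[idx [idxE idx_inj _]] _].
have inS (ctor : 'I_n -> opf_eq n) (S : {set 'I_n}) :
    injective ctor -> {in S, forall i, opf_eq_present N (ctor i)} ->
    #|(idx \o ctor) @: S| = #|S| /\ (idx \o ctor) @: S \subset eq_idx.
  move=> ctor_inj Sp; split; last first.
    by apply/subsetP => _ /imsetP[i iS ->]; apply/idxE/Sp.
  by apply: card_in_imset => i j iS jS /idx_inj/ctor_inj; apply; apply: Sp.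
have dis (c1 c2 : 'I_n -> opf_eq n) (S1 S2 : {set 'I_n}) :
    (forall i j, c1 i <> c2 j) ->
    {in S1, forall i, opf_eq_present N (c1 i)} ->
    {in S2, forall i, opf_eq_present N (c2 i)} ->
    [disjoint (idx \o c1) @: S1 & (idx \o c2) @: S2].
  move=> c12 p1 p2; rewrite -setI_eq0; apply/eqP/setP => k; rewrite !inE.
  apply/negP => /andP[/imsetP[i iS ->] /imsetP[j jS]].
  by move/idx_inj => /(_ (p1 i iS) (p2 j jS)) /c12.
pose L := ~: gen N.
have cL : #|L| = (n - #|gen N|)%N by rewrite cardsCs setCK card_ord.
have pRe : {in L, forall i, opf_eq_present N (ReBalance i)}.
  by move=> i; rewrite inE.
have pIm : {in L, forall i, opf_eq_present N (ImBalance i)}.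
  by move=> i; rewrite inE.
have pV : {in fixedV N, forall i, opf_eq_present N (FixedVoltage i)} by [].
have Re_inj : injective (@ReBalance n) by move=> i j [].
have Im_inj : injective (@ImBalance n) by move=> i j [].
have V_inj : injective (@FixedVoltage n) by move=> i j [].
have [c1 s1] := inS _ _ Re_inj pRe.
have [c2 s2] := inS _ _ Im_inj pIm.
have [c3 s3] := inS _ _ V_inj pV.
have ReIm i j : @ReBalance n i <> ImBalance j by [].
have ReV i j : @ReBalance n i <> FixedVoltage j by [].
have ImV i j : @ImBalance n i <> FixedVoltage j by [].
rewrite -cL mul2n -addnn -{1}c1 -c2 -c3.
have cardsU_disjoint (S1 S2 : {set 'I_(m + l)}) :
    [disjoint S1 & S2] -> (#|S1| + #|S2| = #|S1 :|: S2|)%N.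
  by move=> S12; rewrite cardsU disjoint_setI0 // cards0 subn0.
rewrite (cardsU_disjoint _ _ (dis _ _ _ _ ReIm pRe pIm)) cardsU_disjoint.
  by apply: subset_leq_card; rewrite !subUset s1 s2 s3.
rewrite disjoints_subset subUset -!disjoints_subset.
by rewrite (dis _ _ _ _ ReV pRe pV) (dis _ _ _ _ ImV pIm pV).
Qed.

Theorem corollary2 (R : realType) (n m l : nat)
    (N : network R n) (p : sdp R n m l) (X0 : 'M[R[i]]_n) :
  (1 <= n)%N ->
  opf_relaxation N p ->
  slater p ->
  (forall X y, primal_optimal p X -> dual_optimal p y ->
     strictly_complementary p X y) ->
  real_free eq_idx (coefs p) ->
  primal_optimal p X0 ->
  primal_nondegenerate p X0 ->
  ((#|gen N|%:R : R) <= 2^-1 * (#|active p X0| + #|fixedV N|)%:R ->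
     forall X, primal_optimal p X -> (1 < \rank X)%N) /\
  ((#|gen N|%:R : R) <= 2^-1 * #|fixedV N|%:R ->
     forall X, primal_optimal p X -> (1 < \rank X)%N).
Proof.
move=> n_gt0 opf [[Xhat [Xfeas Xpd Xineq]] [y0 [y0feas _ _]]] sc Afree.
move=> X0opt X0nd.
have [y yopt] := dual_optimum_exists Xfeas Xpd Xineq Afree y0feas.
suff main : (2 * #|gen N| <= #|active p X0| + #|fixedV N|)%N ->
    forall X, primal_optimal p X -> (1 < \rank X)%N.
  have halve (a b : nat) : (a%:R : R) <= 2^-1 * b%:R -> (2 * a <= b)%N.
    by rewrite mulrC ler_pdivlMr // mulrC -natrM ler_nat.
  by split=> /halve hN; apply: main; lia.
move=> hN X Xopt.
have -> : \rank X = \rank X0.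
  have := sc X y Xopt yopt; have := sc X0 y X0opt yopt.
  by rewrite /strictly_complementary; lia.
rewrite ltnNge; apply/negP => rank_le1.
have := card_primal_nondegenerate X0nd; have := card_opf_eq opf.
(* Guards the truncated subtraction [n - #|gen N|]. *)
have : (#|gen N| <= n)%N by have := max_card (mem (gen N)); rewrite card_ord.
(* The number of equality and active constraints is at least 2n, while the dimension bound is 0 for
   rank 0 and 2n - 1 for rank 1; both contradict [n_gt0]-positive [n]. *)
by move: rank_le1; case: (\rank X0) => [|[|//]] _; lia.
Qed.
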